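(* Let $F$ be a field with characteristic prime to $6$ (characteristic $0$ allowed) and let $A$ be a unital commutative $F$-algebra satisfying $$x^3(x^2y)-(x^2)^2(xy)=0\qquad\text{for all }x,y\in A.$$ Then $A$ is Jordan.
   Context: Algebras are commutative, not necessarily associative. $x^2=xx$, $x^3=x(xx)$, $(x^2)^2=x^2x^2$. A commutative algebra is Jordan if $x^2(xy)=x(x^2y)$ for all $x,y$. *)

(* Defs.v *)
From HB Require Import structures.
From mathcomp Require Import all_boot all_order all_algebra.

Set Implicit Arguments.
Unset Strict Implicit.
Unset Printing Implicit Defensive.

Import GRing.Theory.
Local Open Scope ring_scope.

(* MathComp's algebra structures are all associative, so a not necessarily    *)
(* associative F-algebra is given by a left F-module A, of any dimension,     *)
(* together with a bilinear product mul : {bilinear A -> A -> A}.             *)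

Section NonAssociativeAlgebra.
Variables (F : fieldType) (A : lmodType F) (mul : {bilinear A -> A -> A}).

Definition alg_sq (x : A) : A := mul x x.

Definition alg_cube (x : A) : A := mul x (alg_sq x).

Definition jordan_algebra : Prop :=
  commutative mul /\
  forall x y : A, mul (alg_sq x) (mul x y) = mul x (mul (alg_sq x) y).

End NonAssociativeAlgebra.

(* Main.v *)
Require Import Defs.
From HB Require Import structures.
From mathcomp Require Import all_boot all_order all_algebra.

Set Implicit Arguments.
Unset Strict Implicit.
Unset Printing Implicit Defensive.

Import GRing.Theory.
Local Open Scope ring_scope.

(** Write L_z for multiplication by z. The hypothesis says that the defect
    x^3 (x^2 y) - (x^2)^2 (x y) vanishes. Replace x by e + x, with e the unit.
    The terms of degree 0 and 1 in x cancel, the term of degree 5 is the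
    defect at x itself, and what remains is
      defect2 x y + defect3 x y + defect4 x y = 0,
    where defectk is homogeneous of degree k in x and
      defect2 x y = 2 (x (x y) - x^2 y).
    Adding the relations at x and -x kills the odd part and leaves
    defect2 + defect4 = 0; at 2x this becomes 4 defect2 + 16 defect4 = 0, so
    12 defect2 = 0. Substituting only x, -x, 2x and -2x, rather than
    interpolating in a scalar parameter, keeps every division among powers
    of 2 and 3, so the argument also covers the field with five elements.

    Hence x^2 y = x (x y), that is L_{x^2} = L_x^2. Then L_{x^2} commutes with
    L_x, which is the Jordan identity. *)

Lemma natf_neq0_coprime (F : fieldType) (m n : nat) :
  (forall p : nat, p \in [pchar F] -> coprime p m) ->
  (0 < n)%N -> {subset \pi(n) <= \pi(m)} -> n%:R != 0 :> F.
Proof.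
move=> charF n_gt0 sub_pi; rewrite natf_neq0_pchar /pnat n_gt0 /=.
apply/allP=> p p_n; apply/negP=> p_char.
have p_prime : prime p by apply: pcharf_prime p_char.
have := charF p p_char; rewrite prime_coprime //.
by have := sub_pi p p_n; rewrite mem_primes => /and3P[_ _ ->].
Qed.

Section UnitalCommutativeAlgebra.

Variables (F : fieldType) (A : lmodType F) (mul : {bilinear A -> A -> A}).

Local Notation sq := (alg_sq mul).
Local Notation cube := (alg_cube mul).

Definition defect (x y : A) : A :=
  mul (cube x) (mul (sq x) y) - mul (sq (sq x)) (mul x y).

Definition defect2 (x y : A) : A := (mul x (mul x y) - mul (sq x) y) *+ 2.

Definition defect3 (x y : A) : A :=
  (mul x (mul (sq x) y) - mul (cube x) y) *+ 3.

Definition defect4 (x y : A) : A :=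
  mul (sq x) (mul (sq x) y) *+ 3
  - (mul (cube x) (mul x y) *+ 2 + mul (sq (sq x)) y).

Let mulZE := (linearZl_LR mul, linearZr_LR mul).

Lemma sqZ (a : F) (x : A) : sq (a *: x) = a ^+ 2 *: sq x.
Proof. by rewrite /alg_sq !mulZE /= scalerA. Qed.

Lemma cubeZ (a : F) (x : A) : cube (a *: x) = a ^+ 3 *: cube x.
Proof. by rewrite /alg_cube sqZ !mulZE /= scalerA. Qed.

Lemma defect2Z (a : F) (x y : A) : defect2 (a *: x) y = a ^+ 2 *: defect2 x y.
Proof.
by rewrite /defect2 sqZ !mulZE /= scalerA -expr2 -scalerBr scalerMnr.
Qed.

Lemma defect3Z (a : F) (x y : A) : defect3 (a *: x) y = a ^+ 3 *: defect3 x y.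
Proof.
by rewrite /defect3 sqZ cubeZ !mulZE /= scalerA -exprS -scalerBr scalerMnr.
Qed.

Lemma defect4Z (a : F) (x y : A) : defect4 (a *: x) y = a ^+ 4 *: defect4 x y.
Proof.
rewrite /defect4 !sqZ cubeZ !mulZE /= !scalerA -!exprD -exprSr -exprM.
by rewrite !scalerMnr -scalerDr -scalerBr.
Qed.

(** Once L_{x^2} = L_x^2, both sides of the Jordan identity are L_x^3 y. *)
Lemma jordan_of_alternative :
  commutative mul -> (forall x y, mul x (mul x y) = mul (sq x) y) ->
  jordan_algebra mul.
Proof. by move=> mulC alt; split=> // x y; rewrite -!alt. Qed.

Variable e : A.
Hypotheses (mulC : commutative mul) (mul1 : left_id e mul).

Let mule : right_id e mul. Proof. by move=> x; rewrite mulC mul1. Qed.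

Let mulE := (mul1, mule, mulZE, linearDl mul, linearDr mul).

Lemma sq_shift x : sq (e + x) = e + 2%:R *: x + sq x.
Proof. by rewrite /alg_sq !mulE scaler_nat mulr2n !addrA. Qed.

Lemma cube_shift x : cube (e + x) = e + 3%:R *: x + 3%:R *: sq x + cube x.
Proof.
rewrite /alg_cube sq_shift !mulE /= !scaler_nat -/(sq x).
by rewrite [LHS](AC (3*3) (1*(4*2)*(5*3)*6)) /= -mulrS -mulrSr.
Qed.

Lemma sq_sq_shift x :
  sq (sq (e + x)) =
  e + 4%:R *: x + 6%:R *: sq x + 4%:R *: cube x + sq (sq x).
Proof.
rewrite sq_shift {1}/alg_sq !mulE /= !scalerDr !scalerA -!natrM !scaler_nat.
rewrite -/(sq x) (mulC (sq x)) -/(cube x) -/(sq (sq x)).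
rewrite [LHS](AC (3*3*3) (1*(2*4)*((3*7)*5)*(6*8)*9)) /=.
by rewrite -!mulrnDr -mulr2n -mulrnDr.
Qed.

(** Both products have total degree 5 in x, so each contributes 5 x y in
    degree 1, next to y in degree 0; these cancel, and so do the two terms
    6 x^2 (x y) in degree 3. *)
Lemma defect_shift x y :
  defect (e + x) y = defect2 x y + defect3 x y + defect4 x y + defect x y.
Proof.
rewrite /defect sq_sq_shift cube_shift sq_shift.
rewrite !mulE /= !scalerDr !scalerA -!natrM !scaler_nat.
rewrite /defect2 /defect3 /defect4.
set x1 := mul x y.
set x2 := mul (sq x) y.
set x3 := mul (cube x) y.
set x4 := mul (sq (sq x)) y.
set x11 := mul x x1.
set x12 := mul x x2.
set x21 := mul (sq x) x1.
set x22 := mul (sq x) x2.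
set x31 := mul (cube x) x1.
set x32 := mul (cube x) x2.
set x41 := mul (sq (sq x)) x1.
(* The part shared by the two expanded products. *)
pose c := y + x1 *+ 5 + x21 *+ 6 + x11 *+ 4 + x2 *+ 4 + x3 + x31 *+ 2.
rewrite [X in X - _ = _](_ : _ = x11 *+ 2 + x12 *+ 3 + x22 *+ 3 + x32 + c);
  last first.
  rewrite /c (mulrnDr x1 2 3) (mulrnDr x11 2 4) (mulrS x2 3).
  by rewrite [LHS](AC (3*(1*2*1)*3*3)
                      ((5*7*10*13)*(1*(2*4)*9*6*(3*8)*11*12))).
rewrite [X in _ - X = _](_ : _ =
    x2 *+ 2 + x3 *+ 3 + (x31 *+ 2 + x4) + x41 + c); last first.
  rewrite /c (mulrS x1 4) (mulrnDr x2 2 4) (mulrSr x3 3) (mulrnDr x31 2 2).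
  by rewrite [LHS](AC (2*2*(2*1)*(2*2)*2)
                      ((5*8*(10*12)*13)*(1*(2*3)*7*4*6*9*11))).
rewrite opprD addrACA subrr addr0 !mulrnBl.
by rewrite !opprD [LHS](AC (4*(1*1*2*1)) (1*5*(2*6)*(3*(7*8))*(4*9))).
Qed.

(** Parity and then a doubling isolate the quadratic component of the shifted
    identity, and that component is twice the alternative law. *)
Lemma alternative_of_defect_eq0 :
  2%:R != 0 :> F -> 3%:R != 0 :> F ->
  (forall x y, defect x y = 0) ->
  forall x y, mul x (mul x y) = mul (sq x) y.
Proof.
move=> two_neq0 three_neq0 defect0.
have sum0 x y : defect2 x y + defect3 x y + defect4 x y = 0.
  by have := defect_shift x y; rewrite !defect0 addr0.
have even0 x y : defect2 x y + defect4 x y = 0.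
  have := sum0 (-1 *: x) y.
  rewrite defect2Z defect3Z defect4Z sqrrN !expr1n scale1r.
  rewrite exprS sqrrN expr1n mulr1 scaleN1r.
  rewrite (exprM _ 2 2) sqrrN !expr1n scale1r => sumN0.
  apply: (scalerI two_neq0); rewrite scaler0 scaler_nat mulr2n.
  rewrite -[RHS](addr0 0) -{1}(sum0 x y) -sumN0.
  by rewrite [RHS](AC (3*3) ((1*3)*(4*6)*(2*5))) /= subrr addr0.
(* 12 = 16 - 4: the components of degrees 4 and 2 scale by these at 2x. *)
have twelve0 x y : 12%:R *: defect2 x y = 0.
  have := even0 (2%:R *: x) y; rewrite defect2Z defect4Z.
  have /eqP := even0 x y; rewrite addrC addr_eq0 => /eqP ->.
  rewrite -!natrX scalerN -scalerBl => /eqP; rewrite -oppr_eq0 -scaleNr opprB.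
  by rewrite -natrB // => /eqP.
move=> x y; apply/eqP; rewrite -subr_eq0.
have /eqP := twelve0 x y.
rewrite /defect2 -scaler_nat scalerA -natrM scaler_eq0.
by rewrite (natrM _ 8 3) (natrM _ 4 2) (natrM _ 2 2) !mulf_eq0
  (negPf two_neq0) (negPf three_neq0).
Qed.

End UnitalCommutativeAlgebra.

Theorem proposition6p6 (F : fieldType)
    (charF : forall p : nat, p \in [pchar F] -> coprime p 6)
    (A : lmodType F) (mul : {bilinear A -> A -> A}) (e : A)
    (mulC : commutative mul)
    (mul1 : left_id e mul)
    (identity : forall x y : A,
      mul (alg_cube mul x) (mul (alg_sq mul x) y)
      - mul (alg_sq mul (alg_sq mul x)) (mul x y) = 0) :
  jordan_algebra mul.
Proof.
apply: jordan_of_alternative => //.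
by apply: (alternative_of_defect_eq0 mulC mul1) => //;
  apply: natf_neq0_coprime charF _ _ => // p; rewrite !mem_primes /=;
  case/andP=> p_prime p_n; rewrite p_prime (dvdn_trans p_n).
Qed.
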